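(* Let $n,k$ be integers with $2\le k\le n-1$ and $n\le 2k$. Then the number $w_{n,k}$ of vertices of $G(n)$ contained in some closed $k$-walk equals $\dfrac{n!}{(n-k)!}$.
   Context: For a sequence of distinct integers $c_1\cdots c_t$, $\mathrm{st}(c_1\cdots c_t)$ is the unique permutation $d_1\cdots d_t$ of $\{1,\dots,t\}$ with $d_i<d_j$ iff $c_i<c_j$. $G(n)$ is the directed multigraph whose vertices are the permutations of $\{1,\dots,n\}$ (one-line notation) and whose edges are the permutations $c_1\cdots c_{n+1}$ of $\{1,\dots,n+1\}$, the edge $c_1\cdots c_{n+1}$ going from $\mathrm{st}(c_1\cdots c_n)$ to $\mathrm{st}(c_2\cdots c_{n+1})$; so there is an edge from $x_1\cdots x_n$ to $w_1\cdots w_n$ iff $\mathrm{st}(x_2\cdots x_n)=\mathrm{st}(w_1\cdots w_{n-1})$. A closed $k$-walk $(v_1,\dots,v_k)$ is a sequence of vertices with an edge from $v_i$ to $v_{i+1}$ for $i<k$ and from $v_k$ to $v_1$. *)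

(* Defs.v *)
From mathcomp Require Import all_boot all_fingroup.
Set Implicit Arguments.
Unset Strict Implicit.
Unset Printing Implicit Defensive.

(* Permutations are written in one-line notation on {0, .., n-1} instead of   *)
(* {1, .., n}: s : 'S_n stands for the word (s 0 + 1) ... (s (n-1) + 1).      *)

(* [st_of c d] says that d is order-isomorphic to the word c_0 ... c_(t-1).   *)
Definition st_of (t : nat) (c : 'I_t -> nat) (d : 'S_t) : bool :=
  [forall i, forall j, (d i < d j) == (c i < c j)].

(* The default 1 is never used on words with distinct letters, see [stP].     *)
Definition st (t : nat) (c : 'I_t -> nat) : 'S_t :=
  odflt 1%g [pick d | st_of c d].

Lemma st_of_unique (t : nat) (c : 'I_t -> nat) (d d' : 'S_t) :
  st_of c d -> st_of c d' -> d = d'.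
Proof.
have rank (e : 'S_t) i : st_of c e -> nat_of_ord (e i) = #|[set j | c j < c i]|.
  move=> He.
  have E : [set j | c j < c i] = e @^-1: [set j : 'I_t | j < e i].
    apply/setP=> j; rewrite !inE.
    by move/forallP: He => /(_ j)/forallP/(_ i)/eqP ->.
  rewrite E on_card_preimset; last exact/onW_bij/injF_bij/perm_inj.
  rewrite -sum1_card (eq_bigl (fun j : 'I_t => j < e i)); last first.
    by move=> j; rewrite inE.
  rewrite (big_ord_narrow (ltnW (ltn_ord (e i)))) sum1_card.
  by rewrite card_ord.
move=> Hd Hd'; apply/permP=> i; apply: val_inj.
by rewrite /= (rank _ _ Hd) (rank _ _ Hd').
Qed.

Lemma stP (t : nat) (c : 'I_t -> nat) : injective c -> st_of c (st c).
Proof.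
move=> cI; rewrite /st; case: pickP => [d //|no]; exfalso.
have lt_t i : #|[set j | c j < c i]| < t.
  suff: #|[set j | c j < c i]| < #|[set: 'I_t]| by rewrite cardsT card_ord.
  apply: proper_card.
  by apply/properP; split; [exact: subsetT | exists i; rewrite !inE ?ltnn].
have mono i j : (#|[set l | c l < c i]| < #|[set l | c l < c j]|) = (c i < c j).
  have [lt_ij|le_ji] := ltnP (c i) (c j).
    apply: proper_card; apply/properP; split.
      by apply/subsetP=> l; rewrite !inE => /ltn_trans; apply.
    by exists i; rewrite !inE ?ltnn.
  apply/negbTE; rewrite -leqNgt; apply: subset_leq_card.
  by apply/subsetP=> l; rewrite !inE => /leq_trans; apply.
pose f i : 'I_t := Ordinal (lt_t i).
have fI : injective f.
  move=> i j [eq_f]; apply: cI.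
  by case: (ltngtP (c i) (c j)) => //; rewrite -mono eq_f ltnn.
have := no (perm fI) => /negP; apply.
by apply/forallP=> i; apply/forallP=> j; rewrite !permE /= mono.
Qed.

(* The edges of G(n) are the elements of 'S_n.+1, its vertices those of 'S_n. *)
Definition src (n : nat) (e : 'S_n.+1) : 'S_n :=
  st (fun i : 'I_n => e (widen_ord (leqnSn n) i)).

Definition tgt (n : nat) (e : 'S_n.+1) : 'S_n :=
  st (fun i : 'I_n => e (lift ord0 i)).

Definition adj (n : nat) : rel 'S_n :=
  fun x w => [exists e : 'S_n.+1, (src e == x) && (tgt e == w)].

(* Vertices may repeat; [path.cycle] includes the edge from v_k to v_1.       *)
Definition closed_walk (n k : nat) (v : k.-tuple 'S_n) : bool :=
  path.cycle (@adj n) v.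

Definition w (n k : nat) : nat :=
  #|[set x : 'S_n | [exists v : k.-tuple 'S_n, closed_walk v && (x \in v)]]|.

(* Main.v *)
Require Import Defs.
From mathcomp Require Import all_boot all_order all_algebra all_fingroup.
From mathcomp Require Import zify.
Import GRing.Theory.
Set Implicit Arguments.
Unset Strict Implicit.
Unset Printing Implicit Defensive.

(** A vertex [x] lies on a closed [k]-walk iff the words formed by its first and
    last [n - k] letters are order-isomorphic.  Necessity: each step of a walk
    shifts the common pattern by one.  Sufficiency: two linear orders that agree
    on the intersection of their supports amalgamate, so there is a word of
    length [n + k] whose first and last [n] letters both have pattern [x]; its
    windows of length [n] form the walk.  As [n <= 2 k], the two blocks are
    disjoint, so permuting the letters of the first block makes ['S_(n - k)] act
    freely on ['S_n], and each orbit contains exactly one such vertex. *)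

(** * Standardization as comparison of letters *)

Lemma st_ofP (t : nat) (c : 'I_t -> nat) (d : 'S_t) :
  reflect (forall i j, (d i < d j) = (c i < c j)) (st_of c d).
Proof.
apply: (iffP forallP) => [H i j|H i]; first by have /forallP/(_ j)/eqP := H i.
by apply/forallP=> j; rewrite H.
Qed.

Lemma st_unique (t : nat) (c : 'I_t -> nat) (d : 'S_t) :
  injective c -> (forall i j, (d i < d j) = (c i < c j)) -> st c = d.
Proof.
by move=> cI H; apply: st_of_unique (stP cI) _; apply/st_ofP.
Qed.

Lemma st_lt (t : nat) (c : 'I_t -> nat) : injective c ->
  forall i j, (st c i < st c j) = (c i < c j).
Proof. by move=> cI; apply/st_ofP/stP. Qed.

Lemma st_eqP (t : nat) (c c' : 'I_t -> nat) :
  injective c -> injective c' ->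
  st c = st c' <-> forall i j, (c i < c j) = (c' i < c' j).
Proof.
move=> cI cI'; split=> [E i j|H]; first by rewrite -(st_lt cI) -(st_lt cI') E.
by apply: st_unique => // i j; rewrite st_lt // H.
Qed.

Lemma perm_val_inj (T : Type) (n : nat) (f : T -> 'I_n) (x : 'S_n) :
  injective f -> injective (fun i => x (f i) : nat).
Proof. by move=> fI i j /val_inj/perm_inj/fI. Qed.
Arguments perm_val_inj {T n f} x.

(** * Counting words whose two disjoint blocks have the same pattern *)

Section CountEqualPatterns.
Variables (m n : nat) (f g : 'I_m -> 'I_n).
Hypotheses (fI : injective f) (gI : injective g).
Hypothesis fg : forall i j, f i != g j.

Let block_fun (s : 'S_m) (p : 'I_n) : 'I_n :=
  if [pick i | f i == p] is Some i then f (s i) else p.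

Let block_funf s i : block_fun s (f i) = f (s i).
Proof.
rewrite /block_fun; case: pickP => [j /eqP/fI -> //|/(_ i)].
by rewrite eqxx.
Qed.

Let block_fun_out s p : (forall i, f i != p) -> block_fun s p = p.
Proof.
by move=> H; rewrite /block_fun; case: pickP => // j; rewrite (negbTE (H j)).
Qed.

Let block_fun_inj s : injective (block_fun s).
Proof.
apply: (@can_inj _ _ _ (block_fun s^-1)) => p.
case: (pickP (fun i => f i == p)) => [i /eqP <-|H].
  by rewrite !block_funf permK.
by rewrite !block_fun_out // => i; rewrite ?block_fun_out // H.
Qed.

Let block s := perm (@block_fun_inj s).

(** The discrepancy between the two block patterns: it is trivial exactly when they agree, and
    rearranging the first block by [s] multiplies it by [s^-1]. Hence all its fibres have the same
    size. *)
Let rel_pat (y : 'S_n) : 'S_m :=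
  (st (fun i => y (g i) : nat) * (st (fun i => y (f i) : nat))^-1)%g.

Let rel_pat_block s y : rel_pat (block s * y)%g = (rel_pat y * s^-1)%g.
Proof.
rewrite /rel_pat.
have -> : st (fun i => (block s * y)%g (g i) : nat) = st (fun i => y (g i) : nat).
  apply/st_eqP; [exact: perm_val_inj | exact: perm_val_inj | ] => i j.
  by rewrite !permM !permE !block_fun_out.
have -> : st (fun i => (block s * y)%g (f i) : nat)
    = (s * st (fun i => y (f i) : nat))%g.
  apply: st_unique => [|i j]; first exact: perm_val_inj.
  by rewrite !permM !permE !block_funf st_lt //; apply: perm_val_inj.
by rewrite invMg mulgA.
Qed.

Lemma card_equal_patterns :
  #|[set y : 'S_n | st (fun i => y (f i) : nat) == st (fun i => y (g i) : nat)]|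
    * m`! = n`!.
Proof.
have -> :
    [set y : 'S_n | st (fun i => y (f i) : nat) == st (fun i => y (g i) : nat)] =
    [set y | rel_pat y == 1%g].
  by apply/setP=> y; rewrite !inE /rel_pat -eq_mulgV1 eq_sym.
rewrite -(card_Sn n) -[in RHS]sum1_card (partition_big rel_pat predT) //=.
rewrite (eq_bigr (fun=> #|[set y | rel_pat y == 1%g]|)) => [|s _].
  by rewrite sum_nat_const card_Sn mulnC.
rewrite sum1_card.
(* Left translation by [block s] carries the fibre over [s] onto the fibre over 1. *)
have -> : [set y | rel_pat y == 1%g]
    = [set (block s * y)%g | y in [set y | rel_pat y == s]].
  apply/setP=> y; rewrite inE; apply/eqP/imsetP => [E|[z]].
    exists ((block s)^-1 * y)%g; last by rewrite mulKVg.
    by rewrite inE -(inj_eq (mulIg s^-1)%g) -rel_pat_block mulKVg E mulgV.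
  by rewrite inE => /eqP E ->; rewrite rel_pat_block E mulgV.
by rewrite card_imset; [apply: eq_card => y; rewrite !inE | exact: mulgI].
Qed.

End CountEqualPatterns.

(** * Gluing two copies of a word along an overlap of [m] letters *)

Section Amalgam.
Variables (m k : nat) (X : nat -> nat) (N : nat).
Hypothesis XN : forall i, i < m + k -> X i < N.
Hypothesis XI : forall i j, i < m + k -> j < m + k -> X i = X j -> i = j.
Hypothesis Xshift : forall i j, i < m -> j < m ->
  (X (k + i) < X (k + j)) = (X i < X j).

(** Indexes the gap between overlap letters in which the value [v] falls. The overlap starts at
    position [k] of the first copy ([h = k]) and at position 0 of the second ([h = 0]). *)
Let rank (h v : nat) := #|[set c : 'I_m | X (h + c) <= v]|.

Let rank_le h v v' : v <= v' -> rank h v <= rank h v'.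
Proof.
move=> le_v; apply/subset_leq_card/subsetP=> c; rewrite !inE.
by move/leq_trans; apply.
Qed.

Let rank_lt h v c : c < m -> v < X (h + c) -> rank h v < rank h (X (h + c)).
Proof.
move=> lt_cm lt_v; apply/proper_card/properP; split.
  by apply/subsetP=> d; rewrite !inE => /leq_trans; apply; apply: ltnW.
by exists (Ordinal lt_cm); rewrite !inE //= -ltnNge.
Qed.

Let rank_shift c : c < m -> rank k (X (k + c)) = rank 0 (X c).
Proof.
move=> lt_cm; apply: eq_card => d; rewrite !inE /= add0n.
by rewrite leqNgt Xshift // -leqNgt.
Qed.

(* Letters are sorted first by the gap of the overlap they fall in, then by the
   copy they come from, then by their value in that copy; a letter of the
   overlap belongs to the first copy and opens its gap. *)
Let a (p : nat) : nat :=
  if p < m + k then (rank k (X p)).*2 * N + X p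
  else (rank 0 (X (p - k))).*2.+1 * N + X (p - k).

Let lex_lt u u' v v' : v < N -> u < u' -> u * N + v < u' * N + v'.
Proof.
move=> Hv lt_u; apply: (@leq_trans (u.+1 * N)); first by rewrite mulSn; lia.
by apply: (@leq_trans (u' * N)); rewrite ?leq_addr // leq_mul2r lt_u orbT.
Qed.

Let lex_le u u' v v' : u <= u' -> v < v' -> u * N + v < u' * N + v'.
Proof. by move=> le_u lt_v; rewrite -addnS leq_add // leq_mul2r le_u orbT. Qed.

Let a_first i j : i < m + k -> j < m + k -> X i < X j -> a i < a j.
Proof.
move=> Hi Hj lt_ij; rewrite /a Hi Hj.
by apply: lex_le => //; rewrite leq_double; apply/rank_le/ltnW.
Qed.

Let aE_last i : i < m + k -> a (k + i) =
  if i < m then (rank 0 (X i)).*2 * N + X (k + i)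
  else (rank 0 (X i)).*2.+1 * N + X i.
Proof.
move=> Hi; rewrite /a addKn (addnC m) ltn_add2l.
by case: ifP => // lt_im; rewrite rank_shift.
Qed.

Let a_last i j : i < m + k -> j < m + k -> X i < X j -> a (k + i) < a (k + j).
Proof.
move=> Hi Hj lt_ij; rewrite !aE_last //.
have le_r := rank_le 0 (ltnW lt_ij).
have XkN l : l < m -> X (k + l) < N by move=> lm; apply: XN; lia.
case: (ltnP i m) => [im|mi]; case: (ltnP j m) => [jm|mj].
- by apply: lex_le; rewrite ?Xshift ?leq_double.
- by apply: lex_lt; [exact: XkN | rewrite ltnS leq_double].
(* The overlap letter at [j] opens a new gap above [X i], so the rank grows strictly, which
   outweighs the odd leading digit of [i]. *)
- apply: lex_lt; first exact: XN.
  by have := @rank_lt 0 (X i) j jm lt_ij; rewrite add0n; lia.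
- by apply: lex_le; rewrite ?ltnS ?leq_double.
Qed.

Let lt_mono (b : nat -> nat) :
  (forall i j, i < m + k -> j < m + k -> X i < X j -> b i < b j) ->
  forall i j, i < m + k -> j < m + k -> (b i < b j) = (X i < X j).
Proof.
move=> b_homo i j Hi Hj.
case: (ltngtP (X i) (X j)) => [/b_homo-> //|/b_homo H|/XI -> //].
  by apply/negbTE; rewrite -leqNgt ltnW ?H.
by rewrite ltnn.
Qed.

Let lt_inj (b : nat -> nat) :
  (forall i j, i < m + k -> j < m + k -> X i < X j -> b i < b j) ->
  forall i j, i < m + k -> j < m + k -> b i = b j -> i = j.
Proof.
move=> b_homo i j Hi Hj E; apply: XI => //.
by case: (ltngtP (X i) (X j)) => // [/(b_homo _ _ Hi Hj)|/(b_homo _ _ Hj Hi)];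
  rewrite E ltnn.
Qed.

Let a_inj p q : p < m + k + k -> q < m + k + k -> a p = a q -> p = q.
Proof.
wlog le_pq : p q / p <= q.
  by move=> W; case/orP: (leq_total p q) => H *; [|symmetry]; apply: W.
move=> Hp Hq eq_a; have [q_lt|q_ge] := ltnP q (m + k).
  have p_lt := leq_ltn_trans le_pq q_lt.
  exact: (lt_inj a_first).
have [p_lt|p_ge] := ltnP p (m + k).
  move: eq_a; rewrite /a p_lt ltnNge q_ge /=.
  have q_N : X (q - k) < N by apply: XN; lia.
  (* Here [p] lies in the first copy and [q] only in the second: the leading digits have opposite
     parity and both low digits are below [N], so the values cannot coincide. *)
  set r := (rank k _).*2; set r' := _.*2.+1 => E.
  have : r != r' by rewrite /r /r'; lia.
  by rewrite neq_ltn => /orP[] /lex_lt lex;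
    [have := lex _ (X (q - k)) (XN p_lt) | have := lex _ (X p) q_N];
    rewrite E ltnn.
have Ep : p = k + (p - k) by lia.
have Eq : q = k + (q - k) by lia.
move: eq_a; rewrite Ep Eq => eq_a; congr (k + _).
by apply: (lt_inj a_last) => //; lia.
Qed.

Lemma amalgam : exists b : nat -> nat,
  [/\ forall p q, p < m + k + k -> q < m + k + k -> b p = b q -> p = q,
      forall i j, i < m + k -> j < m + k -> (b i < b j) = (X i < X j) &
      forall i j, i < m + k -> j < m + k -> (b (k + i) < b (k + j)) = (X i < X j)].
Proof.
exists a; split; [exact: a_inj | exact: lt_mono |].
exact: (@lt_mono (fun i => a (k + i))).
Qed.

End Amalgam.

(** * Walks, windows of a word and cycles *)

Lemma adj_lt (n : nat) (x w : 'S_n) : adj x w ->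
  forall i j i' j' : 'I_n, i' = i.+1 :> nat -> j' = j.+1 :> nat ->
  (w i < w j) = (x i' < x j').
Proof.
case/existsP=> e /andP[/eqP <- /eqP <-] i j i' j' Ei Ej.
rewrite !st_lt; try exact/perm_val_inj/lift_inj.
  by congr (e _ < e _); apply: val_inj; rewrite /= ?Ei ?Ej.
by apply: perm_val_inj => u v [/val_inj].
Qed.

Lemma path_adj_lt (n : nat) (x : 'S_n) (p : seq 'S_n) : path (@adj n) x p ->
  forall i j i' j' : 'I_n,
  i' = size p + i :> nat -> j' = size p + j :> nat ->
  (last x p i < last x p j) = (x i' < x j').
Proof.
elim: p x => [|y p IH] x /= => [_|/andP[xy /IH {}IH]] i j i' j' Ei Ej.
  by congr (x _ < x _); apply: val_inj.
have Hi : size p + i < n by have := ltn_ord i'; lia.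
have Hj : size p + j < n by have := ltn_ord j'; lia.
rewrite (IH i j (Ordinal Hi) (Ordinal Hj)) //.
exact: (adj_lt xy).
Qed.

Definition window (n : nat) (b : nat -> nat) (p : nat) : 'S_n :=
  st (fun i : 'I_n => b (p + i)).

Lemma window_adj (n : nat) (b : nat -> nat) (p : nat) :
  injective (fun i : 'I_n.+1 => b (p + i)) ->
  adj (window n b p) (window n b p.+1).
Proof.
move=> bI; have bIl : injective (fun i : 'I_n => b (p.+1 + i)).
  move=> i j; rewrite !addSnnS => E.
  by apply: (@lift_inj _ ord0); apply: bI.
have bIf : injective (fun i : 'I_n => b (p + i)).
  move=> i j E; apply: val_inj.
  by have [] := bI (widen_ord (leqnSn n) i) (widen_ord (leqnSn n) j) E.
(* The edge is the pattern of the [n.+1] consecutive letters covering both windows. *)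
apply/existsP; exists (st (fun i : 'I_n.+1 => b (p + i))).
apply/andP; split; apply/eqP/st_eqP => //.
- by apply: perm_val_inj => u v [/val_inj].
- by move=> i j; rewrite st_lt.
- exact/perm_val_inj/lift_inj.
- by move=> i j; rewrite st_lt //= !addSnnS.
Qed.

Lemma path_map_iota (T : Type) (e : rel T) (f : nat -> T) (i l : nat) :
  (forall p, i <= p < i + l -> e (f p) (f p.+1)) ->
  path e (f i) (map f (iota i.+1 l)).
Proof.
elim: l i => //= l IH i f_e; rewrite f_e ?leqnn ?addnS ?ltnS ?leq_addr //=.
by apply: IH => p Hp; apply: f_e; lia.
Qed.

(** The closing edge is the last one of the path, since its end [f k] is [f 0]. *)
Lemma cycle_mkseq (T : Type) (e : rel T) (f : nat -> T) (k : nat) :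
  f k = f 0 -> (forall p, p < k -> e (f p) (f p.+1)) -> path.cycle e (mkseq f k).
Proof.
case: k => // k fk f_e; have := @path_map_iota _ e f 0 k.+1 f_e.
have -> : iota 1 k.+1 = rcons (iota 1 k) k.+1.
  by rewrite -(addn1 k) iotaD cats1 addn1.
by rewrite map_rcons fk.
Qed.

(** * Vertices on closed walks, characterized by their end blocks *)

Section ClosedWalks.
Variables m k : nat.
Hypothesis k_gt0 : 0 < k.

Let fst_pos : 'I_m -> 'I_(m + k) := lshift k.
Let lst_pos (i : 'I_m) : 'I_(m + k) := cast_ord (addnC k m) (rshift k i).

Lemma in_closed_walkE (x : 'S_(m + k)) :
  [exists v : k.-tuple 'S_(m + k), closed_walk v && (x \in v)] =
  (st (fun i => x (fst_pos i) : nat) == st (fun i => x (lst_pos i) : nat)).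
Proof.
have fI : injective fst_pos by exact: lshift_inj.
have gI : injective lst_pos by move=> i j /cast_ord_inj/rshift_inj.
apply/idP/eqP => [/existsP[v /andP[cyc /rot_to[r p Ev]]]|].
  have szp : (size p).+1 = k.
    by rewrite -[(size p).+1]/(size (x :: p)) -Ev size_rot size_tuple.
  (* Rotated to start at [x], the cycle is a path of [k] steps from [x] to itself, so [x] is
     compared with its own shift by [k]. *)
  move: cyc; rewrite /closed_walk -(rot_cycle r) Ev /= => /path_adj_lt.
  rewrite last_rcons size_rcons szp => x_shift.
  by apply/st_eqP => [||i j]; [exact: perm_val_inj.. | exact: x_shift].
move/st_eqP => /(_ (perm_val_inj _ fI) (perm_val_inj _ gI)) x_shift.
(* The default 0 is harmless: [amalgam] only speaks of [X] below [m + k]. *)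
pose X i := if insub i is Some o then x o : nat else 0.
have XE (i : 'I_(m + k)) : X i = x i by rewrite /X valK.
have XE' i (Hi : i < m + k) : X i = x (Ordinal Hi) by rewrite -XE.
have [|i j Hi Hj|i j Hi Hj|b [bI b_fst b_lst]] := @amalgam m k X (m + k).
- by move=> i Hi; rewrite XE'.
- by rewrite !XE' => /val_inj/perm_inj[].
- have := x_shift (Ordinal Hi) (Ordinal Hj).
  by rewrite -!XE /= => ->.
pose W := window (m + k) b.
have b_win l p : p + l <= m + k + k -> injective (fun i : 'I_l => b (p + i)).
  move=> le_pl i j /bI E; apply/val_inj/(@addnI p)/E.
    by have := ltn_ord i; lia.
  by have := ltn_ord j; lia.
have W0 : W 0 = x.
  apply: st_unique => [|i j]; first by apply: b_win; lia.
  by rewrite b_fst ?XE ?ltn_ord.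
have Wk : W k = x.
  apply: st_unique => [|i j]; first by apply: b_win; lia.
  by rewrite b_lst ?XE ?ltn_ord.
apply/existsP; exists (Tuple (introT eqP (size_mkseq W k))).
apply/andP; split; last by apply/mapP; exists 0; rewrite ?W0 // mem_iota.
apply: cycle_mkseq => [|p lt_pk]; first by rewrite W0.
(* For [p < k] the [m + k + 1] letters from [p] on fit into the [m + k + k] letters on which [b] is
   injective. *)
by apply/window_adj/b_win; lia.
Qed.

End ClosedWalks.

Unset Implicit Arguments.

Theorem theorem5p1 (n k : nat) (hk2 : 2 <= k) (hkn : k <= n - 1)
    (hn2k : n <= 2 * k) :
  ((w n k)%:R = (n`!)%:R / ((n - k)`!)%:R :> rat)%R.
Proof.
have [m En] : exists m, n = m + k by exists (n - k); lia.
have le_mk : m <= k by lia.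
have k_gt0 : 0 < k by lia.
rewrite {}En addnK {n hkn hn2k} -(@card_equal_patterns m (m + k) (lshift k)
  (fun i => cast_ord (addnC k m) (rshift k i))).
- rewrite natrM mulfK ?Num.Theory.pnatr_eq0 -?lt0n ?fact_gt0 //.
  by congr (_%:R)%R; apply: eq_card => x; rewrite !inE in_closed_walkE.
- exact: lshift_inj.
- by move=> i j /cast_ord_inj/rshift_inj.
(* The blocks are disjoint because [m <= k], which is where [n <= 2 * k] enters. *)
- by move=> i j; rewrite -val_eqE /=; have := ltn_ord i; lia.
Qed.
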